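(* Let $n \geq 2$ and let $m \geq 0$ be an integer with $m \leq \frac{n}{2}$. Then the graph $mK_2 \cup (n-2m)K_1$ is optimally-least in $\mathcal{S}_{n,m}$ for the independence polynomial; that is, $I(mK_2 \cup (n-2m)K_1, x) \leq I(G,x)$ for all $G \in \mathcal{S}_{n,m}$ and all real $x \geq 0$.
   Context: All graphs are finite and simple. $\mathcal{S}_{n,m}$ denotes the set of simple graphs with $n$ vertices and $m$ edges. The independence polynomial of a graph $G$ is $I(G,x) = \sum_{j} i_j x^j$, where $i_j$ is the number of independent sets of vertices of $G$ of cardinality $j$ (including the empty set). $K_r$ is the complete graph on $r$ vertices, $\cup$ denotes disjoint union, and $\ell F$ denotes the disjoint union of $\ell$ copies of the graph $F$. *)

(* Defs.v *)
From HB Require Import structures.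
From mathcomp Require Import all_boot all_order all_algebra.
From mathcomp Require Import reals.

Set Implicit Arguments.
Unset Strict Implicit.
Unset Printing Implicit Defensive.

Import Order.TTheory GRing.Theory Num.Theory.

Local Open Scope ring_scope.

Record sgraph := SGraph {
  vertex :> finType;
  adj : rel vertex;
  adj_sym : symmetric adj;
  adj_irrefl : irreflexive adj }.

Definition edges (G : sgraph) : {set {set G}} :=
  [set [set p.1; p.2] | p : G * G & adj p.1 p.2].

(* The class S_{n,m}: the vertices may form any finite type of cardinality n,
   and graphs are not identified up to isomorphism. *)
Definition in_S (n m : nat) (G : sgraph) : Prop :=
  #|G| = n /\ #|edges G| = m.

Definition independent (G : sgraph) (A : {set G}) : bool :=
  [forall u in A, forall v in A, ~~ adj u v].

Definition num_indep (G : sgraph) (j : nat) : nat :=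
  #|[set A : {set G} | independent A & #|A| == j]|.

Definition indep_poly (R : nzSemiRingType) (G : sgraph) : {poly R} :=
  \poly_(j < #|G|.+1) (num_indep G j)%:R.

Definition complete_rel (r : nat) : rel 'I_r := fun i j => i != j.

Lemma complete_sym r : symmetric (@complete_rel r).
Proof. by move=> i j; rewrite /complete_rel eq_sym. Qed.

Lemma complete_irrefl r : irreflexive (@complete_rel r).
Proof. by move=> i; rewrite /complete_rel eqxx. Qed.

Definition complete (r : nat) : sgraph :=
  SGraph (@complete_sym r) (@complete_irrefl r).

Definition dunion_rel (G H : sgraph) : rel (G + H)%type := fun a b =>
  match a, b with
  | inl u, inl v => adj u v
  | inr u, inr v => adj u v
  | _, _ => false
  end.

Lemma dunion_sym G H : symmetric (@dunion_rel G H).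
Proof. by move=> [u|u] [v|v] //=; apply: adj_sym. Qed.

Lemma dunion_irrefl G H : irreflexive (@dunion_rel G H).
Proof. by move=> [u|u] /=; apply: adj_irrefl. Qed.

Definition dunion (G H : sgraph) : sgraph :=
  SGraph (@dunion_sym G H) (@dunion_irrefl G H).

Definition copies_rel (l : nat) (F : sgraph) : rel ('I_l * F)%type :=
  fun a b => (a.1 == b.1) && adj a.2 b.2.

Lemma copies_sym l F : symmetric (@copies_rel l F).
Proof. by move=> a b; rewrite /copies_rel eq_sym adj_sym. Qed.

Lemma copies_irrefl l F : irreflexive (@copies_rel l F).
Proof. by move=> a; rewrite /copies_rel adj_irrefl andbF. Qed.

Definition copies (l : nat) (F : sgraph) : sgraph :=
  SGraph (@copies_sym l F) (@copies_irrefl l F).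

Definition optimally_least (R : realType) (n m : nat) (H : sgraph) : Prop :=
  in_S n m H /\
  forall G : sgraph, in_S n m G ->
  forall x : R, 0 <= x -> (indep_poly R H).[x] <= (indep_poly R G).[x].

(* Main.v *)
Require Import Defs.
From HB Require Import structures.
From mathcomp Require Import all_boot all_order all_algebra.
From mathcomp Require Import reals.
From mathcomp Require Import ring lra zify.

Set Implicit Arguments.
Unset Strict Implicit.
Unset Printing Implicit Defensive.

Import Order.TTheory GRing.Theory Num.Theory.

(** Pick a random set of vertices, each vertex independently with probability
    x / (1 + x).  A set A then occurs with probability
    x ^ #|A| / (1 + x) ^ n, so I(G, x) / (1 + x) ^ n is the probability that
    no edge has both ends picked.  For a single edge this has probability
    (1 + 2x) / (1 + x) ^ 2.  Such events are decreasing, hence positively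
    correlated (Harris' inequality), so over m edges

      I(G, x) >= (1 + x) ^ n * ((1 + 2x) / (1 + x) ^ 2) ^ m,

    and the events are independent, with equality, as soon as the edges are
    pairwise disjoint.  The graph with m disjoint edges is thus a minimiser.

    The argument below is division-free and adds the edges one at a time.  To
    compare the weights before and after adding the edge {u, v}, group the
    vertex sets by their trace A outside {u, v} (weight_split2); each group has
    four members, and the comparison is made inside each group
    (weight_avoidingU1_le, and weight_avoidingU1_eq when no earlier edge meets
    {u, v}).  Induction on the number of edges gives the bound
    (weight_avoiding_ge) and the case of equality
    (weight_avoiding_matching). *)

(** * Families of sets containing no member of a given family *)

Section AvoidingFamilies.

Variable T : finType.
Implicit Types (A B e : {set T}) (E : {set {set T}}) (u v : T).

Definition avoiding E : {set {set T}} :=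
  [set A : {set T} | [forall e in E, ~~ (e \subset A)]].

Lemma avoidingP E A :
  reflect (forall e, e \in E -> ~~ (e \subset A)) (A \in avoiding E).
Proof. by rewrite inE; apply: forall_inP. Qed.

Lemma avoiding0 : avoiding set0 = setT.
Proof.
by apply/setP => A; rewrite in_setT; apply/avoidingP => e; rewrite inE.
Qed.

Lemma avoidingU1 e E A :
  (A \in avoiding (e |: E)) = (A \in avoiding E) && ~~ (e \subset A).
Proof.
apply/avoidingP/andP => [avA | [/avoidingP avA eA] f].
  split; last by apply: avA; rewrite setU11.
  by apply/avoidingP => f fE; apply: avA; rewrite setU1r.
by rewrite in_setU1 => /predU1P[-> // | /avA].
Qed.

Lemma avoiding_subset E A B :
  A \subset B -> B \in avoiding E -> A \in avoiding E.
Proof.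
move=> AB /avoidingP avB; apply/avoidingP => e eE.
by apply: contra (avB e eE) => eA; apply: subset_trans AB.
Qed.

(** A vertex that lies on no edge can be added to an independent set, which is
    what makes disjoint edges independent of each other. *)
Lemma avoiding_addU1 E A v :
  v \notin cover E -> (v |: A \in avoiding E) = (A \in avoiding E).
Proof.
move=> vE; apply/idP/idP => [|/avoidingP avA].
  by apply: avoiding_subset; apply: subsetUr.
apply/avoidingP => e eE; apply: contra (avA e eE) => /subsetP eA.
apply/subsetP => w we; have /setU1P[wv | //] := eA w we.
by case/negP: vE; rewrite -wv; apply/bigcupP; exists e.
Qed.

End AvoidingFamilies.

(** * Sums over all subsets *)

Section SumsOverSubsets.

Local Open Scope ring_scope.

Variable T : finType.
Implicit Types (A B : {set T}) (u v : T).

Lemma sum_set_split1 (V : nmodType) (f : {set T} -> V) v :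
  \sum_(A : {set T}) f A = \sum_(A : {set T} | v \notin A) (f A + f (v |: A)).
Proof.
rewrite (bigID (fun A : {set T} => v \notin A)) /= big_split /=; congr (_ + _).
rewrite (reindex_onto (fun A => v |: A) (fun A => A :\ v)) /=.
  apply: eq_bigl => A; rewrite setU11 /=.
  by apply/eqP/idP => [<- | vA]; rewrite ?setD11 ?setU1K.
by move=> A /negPn vA; rewrite setD1K.
Qed.

Lemma sum_set_split2 (V : nmodType) (f : {set T} -> V) u v : u != v ->
  \sum_(A : {set T}) f A =
  \sum_(A : {set T} | (v \notin A) && (u \notin A))
     (f A + f (u |: A) + (f (v |: A) + f (u |: (v |: A)))).
Proof.
move=> uv; rewrite (sum_set_split1 f u) big_mkcond (sum_set_split1 _ v).
(* Adding v does not change membership of u, as u != v, so the condition on u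
   left by the first splitting is the same for A and v |: A. *)
rewrite [RHS]big_mkcondr; apply: eq_bigr => A vA.
by rewrite in_setU1 negb_or uv /=; case: ifP => // _; rewrite addr0.
Qed.

Lemma sum_set_exp (R : comPzSemiRingType) (x : R) :
  \sum_(A : {set T}) x ^+ #|A| = (1 + x) ^+ #|T|.
Proof.
rewrite addrC -[RHS]prodr_const bigA_distr /=.
apply: eq_big => [A | A _]; first by rewrite inE.
by rewrite -big_mkcond /= prodr_const.
Qed.

End SumsOverSubsets.

(** * Weights of avoiding families *)

Section WeightedCounts.

Local Open Scope ring_scope.

Variables (T : finType) (R : realDomainType) (x : R).
Implicit Types (A B e : {set T}) (E F : {set {set T}}) (u v : T).

(** The unnormalised probability of F when every point is picked with odds
    x. *)
Definition weight F : R := \sum_(A in F) x ^+ #|A|.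

Lemma weight_split2 F u v : u != v ->
  weight F =
  \sum_(A : {set T} | (v \notin A) && (u \notin A)) x ^+ #|A| *
    ((A \in F)%:R + (u |: A \in F)%:R * x
      + (v |: A \in F)%:R * x + (u |: (v |: A) \in F)%:R * x ^+ 2).
Proof.
move=> uv; rewrite /weight big_mkcond (sum_set_split2 _ uv) /=.
apply: eq_bigr => A /andP[vA uA].
rewrite !cardsU1 in_setU1 negb_or uv uA vA /= !add1n !exprS.
by do 4!case: ifP => _ /=; ring.
Qed.

(** Fix a set A outside {u, v}.  If A, u and v together still avoid E, then so
    do all four sets of the group of A, and both sides are
    (1 + 2x) (1 + x) ^ 2 times x ^ #|A|.  Otherwise the new edge removes nothing
    from the group, and 1 + 2x <= (1 + x) ^ 2 is enough. *)
Lemma weight_avoidingU1_le u v E : 0 <= x -> u != v ->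
  (1 + 2 * x) * weight (avoiding E)
    <= (1 + x) ^+ 2 * weight (avoiding ([set u; v] |: E)).
Proof.
move=> x0 uv; rewrite !(weight_split2 _ uv) !mulr_sumr.
apply: ler_sum => A /andP[vA uA].
have w0 : 0 <= x ^+ #|A| by apply: exprn_ge0.
rewrite mulrCA [leRHS]mulrCA ler_wpM2l //.
rewrite !avoidingU1 !subUset !sub1set !in_setU1 !eqxx !(negPf uA) !(negPf vA).
rewrite (negPf uv) eq_sym (negPf uv) /= !andbT andbF.
have [uvE | _] := boolP (u |: (v |: A) \in avoiding E).
  have AE : A \in avoiding E.
    by apply: avoiding_subset uvE; rewrite setUA subsetUr.
  rewrite AE !(avoiding_subset _ uvE) ?setUS ?subsetUr ?subsetUl //=.
  by rewrite le_eqVlt; apply/orP; left; apply/eqP; ring.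
apply: ler_wpM2r; last first.
  have -> : (1 + x) ^+ 2 = 1 + 2 * x + x ^+ 2 by ring.
  by rewrite lerDl exprn_ge0.
by rewrite !addr_ge0 ?mulr_ge0 ?ler0n // exprn_ge0.
Qed.

(** By avoiding_addU1 the four sets of a group avoid E all together or not at
    all: either both sides are (1 + 2x) (1 + x) ^ 2 times x ^ #|A|, or the group
    contributes zero to both. *)
Lemma weight_avoidingU1_eq u v E : u != v ->
  u \notin cover E -> v \notin cover E ->
  (1 + 2 * x) * weight (avoiding E)
    = (1 + x) ^+ 2 * weight (avoiding ([set u; v] |: E)).
Proof.
move=> uv uE vE; rewrite !(weight_split2 _ uv) !mulr_sumr.
apply: eq_bigr => A /andP[vA uA].
rewrite !avoidingU1 !subUset !sub1set !in_setU1 !eqxx !(negPf uA) !(negPf vA).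
rewrite (negPf uv) eq_sym (negPf uv) /= !andbT andbF !avoiding_addU1 //.
by case: (_ \in _) => /=; ring.
Qed.

Lemma weight_avoiding_ge E : 0 <= x -> {in E, forall e, #|e| = 2} ->
  (1 + 2 * x) ^+ #|E| * (1 + x) ^+ #|T|
    <= (1 + x) ^+ (2 * #|E|) * weight (avoiding E).
Proof.
move=> x0; move Em: #|E| => m; elim: m E Em => [|m IH] E Em E2.
  move/cards0_eq: Em => ->; rewrite avoiding0 muln0 !mul1r.
  by rewrite -sum_set_exp /weight; under [leRHS]eq_bigl do rewrite inE.
have [e eE] : exists e, e \in E by apply/set0Pn; rewrite -card_gt0 Em.
have /eqP/cards2P[u [v [uv ee]]] := E2 e eE.
have EF : [set u; v] |: (E :\ e) = E by rewrite -ee setD1K.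
have Fm : #|E :\ e| = m by move: Em; rewrite (cardsD1 e) eE => -[].
have {}IH := IH _ Fm (fun f => fun fE => E2 f (subsetP (subD1set _ _) f fE)).
have := weight_avoidingU1_le (E :\ e) x0 uv; rewrite EF => step.
rewrite mulnS exprD exprS -[leLHS]mulrA -[leRHS]mulrA.
apply: le_trans (ler_wpM2l _ IH) _; first by lra.
by rewrite mulrCA [leRHS]mulrCA ler_wpM2l ?exprn_ge0 ?addr_ge0.
Qed.

Lemma weight_avoiding_matching E : {in E, forall e, #|e| = 2} -> trivIset E ->
  (1 + x) ^+ (2 * #|E|) * weight (avoiding E)
    = (1 + 2 * x) ^+ #|E| * (1 + x) ^+ #|T|.
Proof.
move Em: #|E| => m; elim: m E Em => [|m IH] E Em E2 Etriv.
  move/cards0_eq: Em => ->; rewrite avoiding0 muln0 !mul1r.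
  by rewrite -sum_set_exp /weight; under eq_bigl do rewrite inE.
have [e eE] : exists e, e \in E by apply/set0Pn; rewrite -card_gt0 Em.
have /eqP/cards2P[u [v [uv ee]]] := E2 e eE.
have EF : [set u; v] |: (E :\ e) = E by rewrite -ee setD1K.
have Fm : #|E :\ e| = m by move: Em; rewrite (cardsD1 e) eE => -[].
have sFE := subD1set E e.
have {}IH := IH _ Fm (fun f => fun fE => E2 f (subsetP sFE f fE))
  (trivIsetS sFE Etriv).
have eF w : w \in e -> w \notin cover (E :\ e).
  move=> we; apply/negP => /bigcupP[f /setD1P[fe fE] wf].
  have /trivIsetP/(_ f e fE eE fe) := Etriv.
  by move/disjointFr/(_ wf); rewrite we.
have [ue ve] : u \in e /\ v \in e by rewrite ee set21 set22.
have := weight_avoidingU1_eq uv (eF u ue) (eF v ve); rewrite EF => step.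
by rewrite mulnS exprD mulrAC -step mulrAC -mulrA IH mulrA -exprS.
Qed.

End WeightedCounts.

(** * Independence polynomials as weights *)

Section EdgesOfGraphs.

Variable G : sgraph.
Implicit Types (u v : G) (A e : {set G}).

Lemma edgesP e :
  reflect (exists u v, adj u v /\ e = [set u; v]) (e \in edges G).
Proof.
apply: (iffP imsetP) => [[[u v] /[!inE] /= uv ->] | [u [v [uv ->]]]].
  by exists u, v; split.
by exists (u, v); rewrite ?inE.
Qed.

Lemma card_edge e : e \in edges G -> #|e| = 2.
Proof.
case/edgesP => u [v [uv ->]]; rewrite cards2.
by case: eqVneq uv => // ->; rewrite adj_irrefl.
Qed.

Lemma independent_avoiding A : independent A = (A \in avoiding (edges G)).
Proof.
apply/forall_inP/avoidingP => [indA e /edgesP[u [v [uv ->]]] | avA u uA].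
  rewrite subUset !sub1set; apply: contraL uv => /andP[uA vA].
  exact: (forall_inP (indA u uA)).
apply/forall_inP => v vA; apply: contraL isT => uv.
suff : [set u; v] \in edges G.
  by move/avA; rewrite subUset !sub1set uA vA.
by apply/edgesP; exists u, v.
Qed.

Lemma horner_indep_poly (R : realDomainType) (x : R) :
  (indep_poly R G).[x]%R = weight x (avoiding (edges G)).
Proof.
rewrite horner_poly /weight.
rewrite (partition_big (fun A : {set G} => inord #|A| : 'I_#|G|.+1) xpredT) //=.
apply: eq_bigr => j _; rewrite /num_indep cardsE -sum1_card natr_sum mulr_suml.
apply: eq_big => [A | A].
  rewrite unfold_in -independent_avoiding; congr (_ && _).
  by rewrite -val_eqE /= inordK // ltnS max_card.
by rewrite unfold_in => /andP[_ /eqP ->]; rewrite mul1r.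
Qed.

End EdgesOfGraphs.

(** * The graph with m disjoint edges *)

Section DisjointEdges.

Variables m k : nat.

Let H := dunion (copies m (complete 2)) (copies k (complete 1)).

Definition copy_of_K2 (i : 'I_m) : {set H} :=
  [set w : H | if w is inl p then p.1 == i else false].

Lemma edges_copies_K2 : edges H = [set copy_of_K2 i | i : 'I_m].
Proof.
have endpoints (i : 'I_m) (a b : 'I_2) : a != b ->
    [set inl (i, a); inl (i, b)] = copy_of_K2 i.
  move=> ab; apply/setP => -[[j c] | w]; rewrite !inE //=.
  have inlE p q : (inl p == inl q :> H) = (p == q) by [].
  rewrite !inlE !xpair_eqE -andb_orr.
  (* Two distinct points exhaust 'I_2. *)
  have -> : (c == a) || (c == b).
    case: a b c ab => [a ?] [b ?] [c ?]; rewrite -!val_eqE /=; lia.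
  exact: andbT.
apply/setP => e; apply/edgesP/imsetP.
  case=> -[[i a] | [i a]] [[[j b] | [j b]]] [] //= /andP[/= /eqP<- ab] ->.
    by exists i => //; apply: endpoints.
  by rewrite /complete_rel !ord1 in ab.
case=> i _ ->; exists (inl (i, ord0)), (inl (i, ord_max)).
by split; [rewrite /= /copies_rel /= eqxx | rewrite endpoints].
Qed.

Lemma card_edges_copies_K2 : #|edges H| = m.
Proof.
rewrite edges_copies_K2 card_imset ?card_ord // => i j /setP/(_ (inl (i, ord0))).
by rewrite !inE /= eqxx => /esym/eqP.
Qed.

Lemma trivIset_edges_copies_K2 : trivIset (edges H).
Proof.
rewrite edges_copies_K2; apply/trivIsetP => _ _ /imsetP[i _ ->] /imsetP[j _ ->].
apply: contraR => /pred0Pn[[p | w]]; rewrite /= !inE //.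
by move=> /andP[/eqP-> /eqP->].
Qed.

Lemma card_copies_K2 : #|H| = 2 * m + k.
Proof. by rewrite card_sum !card_prod !card_ord muln1 mulnC. Qed.

End DisjointEdges.

Theorem theorem5 (R : realType) (n m : nat) (hn : 2 <= n) (hm : 2 * m <= n) :
  optimally_least R n m
    (dunion (copies m (complete 2)) (copies (n - 2 * m) (complete 1))).
Proof.
have vH := card_copies_K2 m (n - 2 * m); rewrite subnKC // in vH.
have eH := card_edges_copies_K2 m (n - 2 * m).
split=> // G [vG eG] x x0; rewrite !horner_indep_poly.
(* Both bounds carry the factor (1 + x) ^ (2 * m), which is cancelled here. *)
have x1 : (0 < (1 + x) ^+ (2 * m))%R by rewrite exprn_gt0 // ltr_wpDr.
rewrite -(ler_pM2l x1).
have := weight_avoiding_matching x (@card_edge _)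
  (trivIset_edges_copies_K2 m (n - 2 * m)).
rewrite eH vH => ->.
by have := weight_avoiding_ge x0 (@card_edge G); rewrite eG vG.
Qed.
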